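(* Let $\Omega=\{1,\dots,d\}^{\mathbb N}$ with the shift $\sigma$, and let $A:\Omega\to\mathbb R$ be Lipschitz continuous. Assume that there is a unique $A$-maximizing measure. Then all the calibrated subactions for $A$ are equal up to an additive constant.
   Context: $\Omega$ carries the metric $d(x,y)=2^{-\min\{n:\ x_n\ne y_n\}}$ and $\sigma(x_0x_1x_2\ldots)=x_1x_2\ldots$. $m(A)=\max\int A\,d\nu$ over $\sigma$-invariant Borel probability measures $\nu$ on $\Omega$; a $\sigma$-invariant probability $\mu$ is $A$-maximizing if $\int A\,d\mu=m(A)$. A calibrated subaction for $A$ is a continuous $u:\Omega\to\mathbb R$ with $u(x)=\max_{\sigma(y)=x}[A(y)+u(y)-m(A)]$ for all $x\in\Omega$. *)

(* Defs.v *)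
From HB Require Import structures.
From mathcomp Require Import all_boot all_order all_algebra.
From mathcomp Require Import all_classical all_reals all_analysis.
From mathcomp Require Import measurable_realfun.

Set Implicit Arguments.
Unset Strict Implicit.
Unset Printing Implicit Defensive.

Import Order.TTheory GRing.Theory Num.Theory.
Import numFieldNormedType.Exports.

Local Open Scope classical_set_scope.
Local Open Scope ring_scope.

(* The space of one-sided sequences over an alphabet with [d.+1 >= 1] letters.
   The phantom parameter [R] is the field in which the distance below takes its
   values. *)
Definition fullshift (R : realType) (d : nat) : Type := nat -> 'I_d.+1.

Section fullshift_metric.
Context (R : realType) (d : nat).
Implicit Types x y z : fullshift R d.

HB.instance Definition _ := gen_eqMixin (fullshift R d).
HB.instance Definition _ := gen_choiceMixin (fullshift R d).
HB.instance Definition _ := isPointed.Build (fullshift R d) (fun=> ord0).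

Definition fullshift_dist x y : R :=
  match pselect (exists n, x n != y n) with
  | left neq_xy => 2 ^- ex_minn neq_xy
  | right _ => 0
  end.

Lemma fullshift_dist_ge0 x y : 0 <= fullshift_dist x y.
Proof.
by rewrite /fullshift_dist; case: pselect => // h; rewrite invr_ge0 exprn_ge0.
Qed.

Lemma fullshift_dist_ge x y n : x n != y n -> 2 ^- n <= fullshift_dist x y.
Proof.
move=> xyn; rewrite /fullshift_dist; case: pselect => [h|]; last first.
  by case; exists n.
case: ex_minnP => k _ /(_ _ xyn) kn.
by rewrite lef_pV2 ?posrE ?exprn_gt0// ler_eXn2l// ltr1n.
Qed.

Lemma fullshift_dist_le1 x y : fullshift_dist x y <= 1.
Proof.
rewrite /fullshift_dist; case: pselect => [h|]; last by rewrite ler01.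
by rewrite invf_le1 ?exprn_gt0// exprn_ege1// ler1n.
Qed.

Lemma fullshift_distxx x : fullshift_dist x x = 0.
Proof.
by rewrite /fullshift_dist; case: pselect => // h; case: ex_minnP => n; rewrite eqxx.
Qed.

Lemma fullshift_dist_positivity x y : fullshift_dist x y = 0 -> x = y.
Proof.
move=> xy0; apply/funext => n; apply/eqP; apply/negPn/negP => /fullshift_dist_ge.
by rewrite xy0 leNgt invr_gt0 exprn_gt0.
Qed.

Let dist_le_sym x y : fullshift_dist x y <= fullshift_dist y x.
Proof.
rewrite {1}/fullshift_dist; case: pselect => [h|_]; last first.
  exact: fullshift_dist_ge0.
by case: ex_minnP => n xyn _; rewrite fullshift_dist_ge// eq_sym.
Qed.

Lemma fullshift_dist_sym x y : fullshift_dist x y = fullshift_dist y x.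
Proof. by apply/eqP; rewrite eq_le !dist_le_sym. Qed.

Lemma fullshift_dist_triangle y x z :
  fullshift_dist x z <= fullshift_dist x y + fullshift_dist y z.
Proof.
rewrite {1}/fullshift_dist; case: pselect => [h|_]; last first.
  by rewrite addr_ge0 ?fullshift_dist_ge0.
case: ex_minnP => n xzn _; have [xyn|] := eqVneq (x n) (y n).
  rewrite (le_trans (@fullshift_dist_ge y z n _)) -?xyn//.
  by rewrite lerDr fullshift_dist_ge0.
move=> /fullshift_dist_ge /le_trans; apply.
by rewrite lerDl fullshift_dist_ge0.
Qed.

HB.instance Definition _ := isMetric.Build R (fullshift R d)
  fullshift_distxx fullshift_dist_positivity fullshift_dist_sym
  fullshift_dist_triangle.

HB.instance Definition _ :=
  @isMeasurable.Build (sigma_display (open : set (set (fullshift R d))))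
    (fullshift R d) <<s open >> (@sigma_algebra0 _ setT _)
    (@sigma_algebraC _ _) (@sigma_algebra_bigcup _ setT _).

End fullshift_metric.

Section ergodic_optimization.
Context (R : realType) (d : nat).
Implicit Types (A u : fullshift R d -> R).
Implicit Types (mu nu : probability (fullshift R d) R).

Definition shift (x : fullshift R d) : fullshift R d := fun n => x n.+1.

Definition is_maximum (S : set R) (m : R) : Prop := S m /\ ubound S m.

Definition lipschitz_continuous A : Prop :=
  exists K : R, forall x y, `|A x - A y| <= K * mdist x y.

Definition shift_invariant nu : Prop :=
  forall B, measurable B -> nu (shift @^-1` B) = nu B.

Definition invariant_integrals A : set R :=
  [set \int[nu]_x A x | nu in shift_invariant].

(* The number [m(A)]. It is mathematically a maximum; [ergodic_maxP] shows that
   the supremum is the maximum as soon as the latter is attained. *)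
Definition ergodic_max A : R := sup (invariant_integrals A).

Definition maximizing A mu : Prop :=
  shift_invariant mu /\ \int[mu]_x A x = ergodic_max A.

(* A term of type [probability] is a function on all sets, measurable or not,
   so that two measures are identified when they agree on Borel sets. *)
Definition unique_maximizing A : Prop :=
  exists mu, maximizing A mu /\
    forall nu, maximizing A nu -> forall B, measurable B -> nu B = mu B.

Definition calibrated_subaction A u : Prop :=
  continuous u /\
  forall x, is_maximum [set A y + u y - ergodic_max A | y in [set y | shift y = x]]
                       (u x).

Lemma lipschitz_continuous_continuous A :
  lipschitz_continuous A -> continuous A.
Proof.
move=> [K AK] x; apply/(@cvgrPdist_lt _ _ _ (nbhs x) _) => e e0.
have K1 : 0 < `|K| + 1 by rewrite ltr_wpDl.
apply/nbhs_ballP; exists (e / (`|K| + 1)) => /=; first by rewrite divr_gt0.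
move=> y; rewrite ballEmdist/= ltr_pdivlMr// => xy.
rewrite (le_lt_trans (AK _ _))// (le_lt_trans _ xy)// mulrC.
by rewrite ler_wpM2l ?mdist_ge0// (le_trans (ler_norm _))// lerDl.
Qed.

Lemma continuous_measurable_fullshift A :
  continuous A -> measurable_fun [set: fullshift R d] A.
Proof.
move=> /continuousP cA.
apply: (measurability _ (RGenOpens.measurableE R)).
move=> _ [_ [a [b ->]] <-]; rewrite setTI.
by apply: sub_sigma_algebra; apply: cA; exact: interval_open.
Qed.

Lemma has_sup_invariant_integrals A :
  lipschitz_continuous A -> has_sup (invariant_integrals A).
Proof.
move=> lipA; have mA := continuous_measurable_fullshift
  (lipschitz_continuous_continuous lipA).
pose x0 : fullshift R d := fun=> ord0.
have [M AM] : exists M : R, forall x, `|A x| <= M.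
  have [K AK] := lipA; exists (`|A x0| + `|K|) => x.
  rewrite -(subrK (A x0) (A x)) addrC (le_trans (ler_normD _ _))// lerD2l.
  rewrite (le_trans (AK _ _))// (le_trans (ler_norm _))// normrM.
  rewrite [`|mdist _ _|]ger0_norm ?mdist_ge0//.
  by rewrite ler_piMr//; exact: fullshift_dist_le1.
split.
  exists (\int[\d_x0]_x A x), (\d_x0 : probability _ _) => //.
exists M => _ [nu _ <-].
have intM : nu.-integrable setT (EFin \o cst M).
  exact: finite_measure_integrable_cst.
apply: (@le_trans _ _ (\int[nu]_x cst M x)); last first.
  by rewrite Rintegral_cst// [X in fine X](probability_setT nu) mulr1.
apply: (@le_Rintegral _ _ R nu setT A (cst M)) => // [|x _]; last exact: le_trans (ler_norm _) (AM x).
apply: le_integrable intM => //; first exact/measurable_EFinP.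
by move=> x _ /=; rewrite lee_fin (le_trans (AM x))// ler_norm.
Qed.

Lemma ergodic_maxP A m : lipschitz_continuous A ->
  is_maximum (invariant_integrals A) m <->
  invariant_integrals A m /\ m = ergodic_max A.
Proof.
move=> /has_sup_invariant_integrals sA; split=> [[Sm ubm]|[+ mE]].
  split=> //; apply/eqP; rewrite eq_le; apply/andP; split.
    exact: ub_le_sup sA.2 _ Sm.
  exact: ge_sup sA.1 ubm.
by rewrite mE => Sm; split=> //; exact: sup_upper_bound.
Qed.

End ergodic_optimization.

(* Main.v *)
Require Import Defs.
From HB Require Import structures.
From mathcomp Require Import all_boot all_order all_algebra.
From mathcomp Require Import all_classical all_reals all_analysis.
From mathcomp Require Import measurable_realfun ring.

(** Let [u] and [v] be calibrated subactions and [w = u - v].  From any point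
    [x], calibration of [u] yields a backward orbit [y] along which
    [u (y k) = A (y k.+1) + u (y k.+1) - m(A)]; since [v] satisfies the
    inequality [>=], [w] is nondecreasing along [y].  A limit [nu] of the
    empirical measures of [y] is invariant and, as [A - m(A)] is the coboundary
    [u \o shift - u] along [y], it is maximizing; hence [nu] is the unique
    maximizing measure [mu], and [w x <= \int w dmu].  Exchanging [u] and [v]
    gives the converse inequality, so [w] is constant.

    The limit of the empirical measures is taken along an ultrafilter: it is a
    positive functional on continuous functions, represented by a measure
    because on clopen sets finite additivity implies sigma-additivity by
    compactness. *)

Set Implicit Arguments.
Unset Strict Implicit.
Unset Printing Implicit Defensive.

Import Order.TTheory GRing.Theory Num.Theory.
Import numFieldNormedType.Exports.

Local Open Scope classical_set_scope.
Local Open Scope ring_scope.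

(** * The topology and Borel sets of the full shift *)

Section fullshift_topology.
Context (R : realType) (d : nat).
Local Notation X := (fullshift R d).
Implicit Types (x y : X) (B : set X) (N : nat).

Definition agree N x y := forall i, (i < N)%N -> x i = y i.

Lemma fullshift_dist_le N x y : agree N x y -> fullshift_dist x y <= 2 ^- N.
Proof.
move=> xy; rewrite /fullshift_dist; case: pselect => [h|_]; last first.
  by rewrite invr_ge0 exprn_ge0.
case: ex_minnP => k xyk _; rewrite lef_pV2 ?posrE ?exprn_gt0//.
rewrite ler_eXn2l ?ltr1n// leqNgt; apply: contraNN xyk => /xy ->.
exact: eqxx.
Qed.

Lemma ball_agree N x y : ball x (2 ^- N : R) y -> agree N x y.
Proof.
rewrite ballEmdist /= => xy i iN; apply/eqP; apply: contraTT isT => xyi.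
have := le_lt_trans (fullshift_dist_ge xyi) xy.
by rewrite ltf_pV2 ?posrE ?exprn_gt0// ltr_eXn2l ?ltr1n// ltnNge ltnW.
Qed.

Lemma agree_ball (e : R) : 0 < e ->
  exists N, forall x y, agree N x y -> ball x e y.
Proof.
move=> e0; have [N _ /(_ N (leqnn N)) Ne] :=
  near_infty_natSinv_expn_lt (PosNum e0).
exists N => x y /fullshift_dist_le xy; rewrite ballEmdist /=.
by apply: le_lt_trans xy _; rewrite -div1r.
Qed.

(** Balls and cylinders refine each other, so topological arguments below reduce to comparing finite
    prefixes. *)
Lemma nbhs_agree x B : nbhs x B <-> exists N, agree N x `<=` B.
Proof.
split=> [/nbhs_ballP[e /= e0 eB]|[N NB]].
  by have [N Ne] := agree_ball e0; exists N => y /Ne /eB.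
apply/nbhs_ballP; exists (2 ^- N); first by rewrite /= invr_gt0 exprn_gt0.
by move=> y /ball_agree /NB.
Qed.

Lemma agree_clopen N B : (forall x y, agree N x y -> B x -> B y) -> clopen B.
Proof.
move=> BN; split.
  by rewrite openE => x Bx; apply/nbhs_agree; exists N => y /BN; exact.
rewrite -openC openE => x Bx; apply/nbhs_agree; exists N => y xy /BN By.
by apply: Bx; apply: By => i /xy.
Qed.

Lemma shift_continuous : continuous (@Defs.shift R d).
Proof.
move=> x B /nbhs_agree[N NB]; apply/nbhs_agree; exists N.+1 => y xy.
by apply: NB => i iN; exact: xy.
Qed.

(** An ultrafilter selects one of the finitely many letters in each coordinate; the sequence of
    selected letters is its limit. *)
Lemma fullshift_compact : compact [set: X].
Proof.
rewrite compact_ultra => F UF _.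
have limF i : {a | F [set x | x i = a]}.
  apply: cid; apply: contrapT => /forallNP Fa.
  have [x] : [set x : X | forall a, x i <> a] !=set0.
    apply: (@filter_ex _ F); apply: filter_forall => a.
    by have [/Fa|] := in_ultra_setVsetC [set x : X | x i = a] UF.
  by move=> /(_ (x i)).
exists (fun i => sval (limF i)); split=> // B /nbhs_agree[N NB].
apply: (filterS NB).
suff : F [set x | forall i : 'I_N, x i = sval (limF i)].
  by apply: filterS => x xN i iN; rewrite -(xN (Ordinal iN)).
by apply: filter_forall => i; exact: svalP (limF i).
Qed.

(** Uniform continuity from compactness: points [b N] violating the bound for every [N] would
    cluster at some [p], against the continuity of [f] at [p]. *)
Lemma continuous_agree (f : X -> R) (e : R) : continuous f -> 0 < e ->
  exists N, forall x y, agree N x y -> `|f x - f y| <= e.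
Proof.
move=> cf e0; apply: contrapT => /forallNP fN.
have e20 : 0 < e / 2 by rewrite divr_gt0.
have bad N : {x | exists y, agree N x y /\ e < `|f x - f y|}.
  apply: cid; apply: contrapT => /forallNP h; apply: (fN N) => x y xy.
  by rewrite leNgt; apply/negP => ?; apply: (h x); exists y.
pose b N := sval (bad N).
have [p [_ pb]] :=
  fullshift_compact (fmap_proper_filter b eventually_filter) filterT.
have /nbhs_agree[N pN] : nbhs p (f @^-1` ball (f p) (e / 2)).
  by apply: cf; exact: nbhsx_ballx.
have Npn : nbhs p (agree N p) by apply/nbhs_agree; exists N.
(* Only indices [n >= N] are kept, so that agreement up to [n] puts the companion point [y] in the
   cylinder of length [N] around [p] as well. *)
have bN : (b @ \oo) [set b n | n in [set n | (N <= n)%N]].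
  by exists N => // n /= Nn; exists n.
have [_ [[n /= Nn <-] pbn]] := pb _ _ bN Npn.
rewrite /b in pbn; case: (bad n) pbn => x /= [y [xy exy]] px.
have py : agree N p y by move=> i iN; rewrite px// xy// (leq_trans iN).
move: exy; apply/negP; rewrite -leNgt (splitr e) -(subrKA (f p)).
rewrite (le_trans (ler_normD _ _))// lerD// ltW//.
  by rewrite distrC; exact: pN.
exact: pN.
Qed.

Lemma continuous_bounded (f : X -> R) : continuous f ->
  exists M, forall x, `|f x| <= M.
Proof.
move=> cf; have : compact (f @` [set: X]).
  apply: continuous_compact; last exact: fullshift_compact.
  exact: continuous_subspaceT.
move=> /compact_bounded [M [_ /(_ (M + 1))]].
rewrite ltrDl ltr01 => /(_ isT) fM.
by exists (M + 1) => x; apply: fM; exists x.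
Qed.

Lemma clopen_indic_continuous B : clopen B -> continuous (\1_B : X -> R).
Proof.
move=> [oB cB] x; apply: (@cvg_near_cst _ _ _ _ (nbhs x) _).
have [Bx|Bx] := pselect (B x).
  have nB : nbhs x B by exact: open_nbhs_nbhs.
  by apply: filterS nB => y By; rewrite !indicE !mem_set.
have nB : nbhs x (~` B).
  by apply: open_nbhs_nbhs; split=> //; exact: closed_openC.
by apply: filterS nB => y By; rewrite !indicE !memNset.
Qed.

(** By compactness there are only countably many clopen sets, so an open set, being the union of the
    clopen sets it contains, is a countable such union. *)
Lemma fullshift_borelE : @measurable _ X = <<s clopen >>.
Proof.
apply/seteqP; split; apply: smallest_sub.
- exact: smallest_sigma_algebra.
- move=> U oU.
  have [F] := clopen_surj fullshift_compact.
  have -> : U = \bigcup_(n in [set n | F n `<=` U]) F n.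
    apply/seteqP; split=> [x Ux|x [n /= nU /nU]//].
    have /nbhs_agree[N NU] : nbhs x U by exact: open_nbhs_nbhs.
    have cN : clopen (agree N x).
      by apply: (@agree_clopen N) => y z yz xy i iN; rewrite xy// yz.
    have [n _ nN] := @surj _ _ _ _ F _ cN; exists n => //=; rewrite nN//.
  rewrite bigcup_mkcond.
  apply: (@sigma_algebra_bigcup _ setT) => n; case: ifP => _; last first.
    exact: (@sigma_algebra0 _ setT).
  by apply: sub_sigma_algebra; apply: (@funS _ _ _ _ F).
- exact: smallest_sigma_algebra.
- by move=> B [oB _]; exact: sub_sigma_algebra.
Qed.

End fullshift_topology.

(** * Positive functionals *)

Section continuous_functions.
Context (R : realType) (d : nat).
Local Notation X := (fullshift R d).
Implicit Types (f g : X -> R).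

(* In the proofs below [nbhs x] is passed explicitly, since unification would
   otherwise unfold it to the entourages of the metric. *)
Lemma fullshift_continuous_cst (a : R) : continuous (cst a : X -> R).
Proof. by move=> x; exact: (@cvg_cst _ _ _ (nbhs x) _). Qed.

Lemma fullshift_continuousD f g :
  continuous f -> continuous g -> continuous (fun x => f x + g x).
Proof.
by move=> cf cg x; exact: (@cvgD _ _ _ (nbhs x) _ f g _ _ (cf x) (cg x)).
Qed.

Lemma fullshift_continuousZ a f : continuous f -> continuous (fun x => a * f x).
Proof.
move=> cf x; have ca := @fullshift_continuous_cst a x.
exact: (@cvgM _ _ (nbhs x) _ _ _ _ _ ca (cf x)).
Qed.

Lemma fullshift_continuous_sum (I : Type) (s : seq I) (f : I -> X -> R) :
  (forall i, continuous (f i)) -> continuous (fun x => \sum_(i <- s) f i x).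
Proof.
move=> cf; elim: s => [|i s IH].
  rewrite (_ : (fun _ => _) = cst 0); last by apply/funext => x; rewrite big_nil.
  exact: fullshift_continuous_cst.
rewrite (_ : (fun _ => _) = (fun x => f i x + \sum_(j <- s) f j x)).
  exact: fullshift_continuousD.
by apply/funext => x; rewrite big_cons.
Qed.

End continuous_functions.

Section positive_functional.
Context (R : realType) (d : nat).
Local Notation X := (fullshift R d).
Implicit Types (f g : X -> R) (I J : (X -> R) -> R) (B : set X).

(** The axioms are restricted to continuous functions, on which the limits defining [ultralimit] are
    known to exist. *)
Record positive_functional I : Prop := PositiveFunctional {
  functionalD : forall f g, continuous f -> continuous g ->
    I (fun x => f x + g x) = I f + I g ;
  functionalZ : forall a f, continuous f -> I (fun x => a * f x) = a * I f ;
  functional_ge0 : forall f, continuous f -> (forall x, 0 <= f x) -> 0 <= I f ;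
  functional_cst1 : I (cst 1) = 1 }.

Lemma functional_sum I (T : Type) (s : seq T) (f : T -> X -> R) :
  positive_functional I -> (forall i, continuous (f i)) ->
  I (fun x => \sum_(i <- s) f i x) = \sum_(i <- s) I (f i).
Proof.
move=> pI cf; elim: s => [|i s IH].
  rewrite (_ : (fun _ => _) = (fun x => 0 * cst 1 x)); last first.
    by apply/funext => x; rewrite big_nil mul0r.
  by rewrite functionalZ// ?mul0r ?big_nil//; exact: fullshift_continuous_cst.
rewrite (_ : (fun _ => _) = (fun x => f i x + \sum_(j <- s) f j x)).
  by rewrite functionalD// ?big_cons ?IH//; exact: fullshift_continuous_sum.
by apply/funext => x; rewrite big_cons.
Qed.

(** Positivity on [e - (f - g)] and [e - (g - f)], together with normalization, makes [I]
    nonexpansive for the uniform norm. *)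
Lemma functional_dist_le I f g (e : R) : positive_functional I ->
  continuous f -> continuous g -> (forall x, `|f x - g x| <= e) ->
  `|I f - I g| <= e.
Proof.
move=> pI cf cg fge.
have c1 := @fullshift_continuous_cst R d 1.
have ce := fullshift_continuousZ (a := e) c1.
have IeE : I (fun x => e * cst 1 x) = e.
  by rewrite functionalZ// functional_cst1// mulr1.
suff le1 (h k : X -> R) : continuous h -> continuous k ->
    (forall x, h x - k x <= e) ->
    I h - I k <= e.
  rewrite ler_norml lerNl opprB.
  by apply/andP; split; apply: le1 => // x;
    rewrite (le_trans _ (fge x))// ?ler_norm// distrC ler_norm.
move=> ch ck hk.
have cNk := fullshift_continuousZ (a := -1) ch.
have := functional_ge0 pI
  (fullshift_continuousD (fullshift_continuousD ce ck) cNk).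
rewrite !functionalD//; last exact: fullshift_continuousD.
rewrite IeE (functionalZ pI) // mulN1r => H.
rewrite lerBlDr -subr_ge0; apply: H => x /=.
by rewrite mulr1 mulN1r subr_ge0 -lerBlDr.
Qed.

(** Every continuous function is a uniform limit of linear combinations of indicators of cylinders,
    which are clopen. *)
Lemma positive_functional_ext I J :
  positive_functional I -> positive_functional J ->
  (forall B, clopen B -> I \1_B = J \1_B) ->
  forall f, continuous f -> I f = J f.
Proof.
move=> pI pJ IJ f cf; apply/eqP; rewrite -subr_eq0 -normr_le0.
apply/ler_addgt0Pr => e e0; rewrite add0r.
have [N fN] := continuous_agree cf (divr_gt0 e0 (ltr0Sn R 1)).
(* The word [t] padded with [ord0] is the sample point at which [f] is evaluated on the cylinder
   [cyl t]. *)
pose word (t : {ffun 'I_N -> 'I_d.+1}) : X :=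
  fun n => if insub n is Some i then t i else ord0.
pose pre (x : X) := [ffun i : 'I_N => x i].
pose cyl t : set X := [set x | pre x = t].
have ccyl t : clopen (cyl t).
  apply: (@agree_clopen _ _ N) => x y xy /= <-.
  by apply/ffunP => i; rewrite !ffunE xy.
pose g x := \sum_t f (word t) * \1_(cyl t) x.
have cg t : continuous (fun x => f (word t) * \1_(cyl t) x : R).
  by apply: fullshift_continuousZ; exact: clopen_indic_continuous.
have gE x : g x = f (word (pre x)).
  rewrite /g (bigD1 (pre x))//= indicE mem_set// mulr1 big1 ?addr0// => t tx.
  by rewrite indicE memNset ?mulr0//= => xt; rewrite xt eqxx in tx.
have fg x : `|f x - g x| <= e / 2.
  rewrite gE; apply: fN => i iN; rewrite /word insubT /pre ffunE//.
have cg' : continuous g by exact: fullshift_continuous_sum.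
have IJg : I g = J g.
  rewrite /g !functional_sum//; apply: eq_bigr => t _.
  by rewrite !functionalZ ?IJ//; exact: clopen_indic_continuous.
rewrite -(subrKA (I g)) {2}IJg (le_trans (ler_normD _ _))// (splitr e) lerD//.
  exact: functional_dist_le.
by rewrite distrC; exact: functional_dist_le.
Qed.

Lemma continuous_integrable (nu : probability X R) f :
  continuous f -> nu.-integrable setT (EFin \o f).
Proof.
move=> cf; have [M fM] := continuous_bounded cf.
have intM : nu.-integrable setT (EFin \o cst M).
  exact: finite_measure_integrable_cst.
apply: le_integrable intM => //.
  by apply/measurable_EFinP; exact: continuous_measurable_fullshift.
by move=> x _ /=; rewrite lee_fin (le_trans (fM x))// ler_norm.
Qed.

Lemma Rintegral_positive_functional (nu : probability X R) :
  positive_functional (fun f => \int[nu]_x f x).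
Proof.
split=> [f g cf cg|a f cf|f cf f0|].
- by rewrite RintegralD//; exact: continuous_integrable.
- by rewrite RintegralZl//; exact: continuous_integrable.
- exact: Rintegral_ge0.
- by rewrite Rintegral_cst// [X in fine X]probability_setT mulr1.
Qed.

End positive_functional.

(** * Riesz representation *)

(** A copy of the space: [fullshift R d] already has the Borel sets as its measurable sets, whereas
    the content to be extended lives on the algebra of clopen sets. *)
Definition clopen_fullshift (R : realType) (d : nat) : Type := fullshift R d.

Section clopen_algebra.
Context (R : realType) (d : nat).

Definition clopen_display : measure_display.
Proof. exact: default_measure_display. Qed.

HB.instance Definition _ := Pointed.copy (clopen_fullshift R d) (fullshift R d).
HB.instance Definition _ := @isAlgebraOfSets.Build clopen_display
  (clopen_fullshift R d) (@clopen (fullshift R d)) clopen0 (@clopenU _)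
  (fun B => @clopenC _ B B).

End clopen_algebra.

Section riesz.
Context (R : realType) (d : nat).
Local Notation X := (fullshift R d).
Variable I : (X -> R) -> R.
Hypothesis pI : positive_functional I.

(* [I] is only known to be nonnegative on indicators of clopen sets; the
   absolute value makes the content nonnegative on every set. *)
Definition clopen_content (B : set (clopen_fullshift R d)) : \bar R :=
  `|I \1_B|%:E.

Lemma clopen_contentE (B : set X) : clopen B -> clopen_content B = (I \1_B)%:E.
Proof.
move=> cB; rewrite /clopen_content ger0_norm//; apply: (functional_ge0 pI) => //.
exact: clopen_indic_continuous.
Qed.

Let clopen_content0 : clopen_content set0 = 0%E.
Proof.
rewrite /clopen_content.
have -> : (\1_set0 : X -> R) = (fun x => 0 * cst 1 x).
  by apply/funext => x; rewrite indicE in_set0 mul0r.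
by rewrite (functionalZ pI) ?mul0r ?normr0//; exact: fullshift_continuous_cst.
Qed.

Let clopen_content_ge0 B : (0 <= clopen_content B)%E.
Proof. by rewrite lee_fin. Qed.

(** A clopen union is compact, hence covered by finitely many of the [F i]; by disjointness the
    others are empty, and the partial sums are eventually constant. *)
Let clopen_content_sigma_additive : semi_sigma_additive clopen_content.
Proof.
move=> F mF tF mUF.
have cF i : clopen (F i : set X) by exact: mF.
have cU : clopen (\bigcup_n F n : set X) by exact: mUF.
have : compact (\bigcup_n F n : set X).
  exact: (subclosed_compact cU.2 (@fullshift_compact R d)).
rewrite compact_cover => /(_ nat setT F (fun i _ => (cF i).1) (fun=> id))[D _ DF].
(* [N] exceeds every index of the finite subcover, so [F i] is empty for [i >= N]. *)
pose N := (\max_(i <- finmap.enum_fset D) i).+1.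
have F_lt i x : F i x -> (i < N)%N.
  move=> Fix; have [j /= jD Fjx] := DF x (ex_intro2 _ _ i Logic.I Fix).
  have <- : j = i by apply: (tF _ _ Logic.I Logic.I); exists x.
  by rewrite ltnS; exact: leq_bigmax_seq.
apply: cvg_near_cst; exists N => // n /= Nn.
transitivity (\sum_(0 <= i < n) I \1_(F i))%:E.
  by rewrite -sumEFin; apply: eq_bigr => i _; rewrite clopen_contentE.
rewrite clopen_contentE// -functional_sum//; last first.
  by move=> i; exact: clopen_indic_continuous.
congr (I _)%:E; apply/funext => x; rewrite [RHS]indicE.
have [[i _ Fix]|Fx] := pselect ((\bigcup_n F n) x); last first.
  rewrite memNset// big1// => i _; rewrite indicE memNset// => Fix.
  by apply: Fx; exists i.
rewrite mem_set; last by exists i.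
rewrite (bigD1_seq i)/= ?iota_uniq ?mem_index_iota//; last first.
  exact: leq_trans (F_lt _ _ Fix) Nn.
rewrite indicE mem_set// big1 ?addr0// => j ji; rewrite indicE memNset// => Fjx.
by move/eqP: ji; apply; apply: (tF _ _ Logic.I Logic.I); exists x.
Qed.

HB.instance Definition _ := isMeasure.Build _ _ _ clopen_content
  clopen_content0 clopen_content_ge0 clopen_content_sigma_additive.

(** The extension is a measure on the sigma-algebra generated by the clopen sets, which
    [fullshift_borelE] identifies with the Borel sets. *)
Definition riesz_measure (B : set X) : \bar R :=
  measure_extension clopen_content B.

Let riesz_measure0 : riesz_measure set0 = 0%E.
Proof. exact: measure0. Qed.

Let riesz_measure_ge0 B : (0 <= riesz_measure B)%E.
Proof. exact: measure_ge0. Qed.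

Let riesz_measure_sigma_additive : semi_sigma_additive riesz_measure.
Proof.
move=> F mF tF mUF; apply: measure_semi_sigma_additive => //.
  by move=> i; have := mF i; rewrite fullshift_borelE.
by move: mUF; rewrite fullshift_borelE.
Qed.

HB.instance Definition _ := isMeasure.Build _ _ _ riesz_measure
  riesz_measure0 riesz_measure_ge0 riesz_measure_sigma_additive.

Lemma riesz_measureE (B : set X) : clopen B -> riesz_measure B = (I \1_B)%:E.
Proof.
move=> cB; rewrite -clopen_contentE//; exact: measurable_mu_extE.
Qed.

Let riesz_measure_setT : riesz_measure setT = 1%E.
Proof.
rewrite riesz_measureE; last exact: clopenT.
by rewrite indicT functional_cst1.
Qed.

HB.instance Definition _ :=
  Measure_isProbability.Build _ _ _ riesz_measure riesz_measure_setT.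

End riesz.

Lemma probability_clopen (R : realType) (d : nat)
    (nu : probability (fullshift R d) R) (B : set (fullshift R d)) : clopen B -> nu B = (\int[nu]_x \1_B x)%:E.
Proof.
move=> cB; have mB : measurable B.
  by rewrite fullshift_borelE; exact: sub_sigma_algebra.
rewrite /Rintegral integral_indic// setIT fineK//.
exact: fin_num_measure.
Qed.

Lemma riesz_representation (R : realType) (d : nat)
    (I : (fullshift R d -> R) -> R) :
  positive_functional I ->
  exists nu : probability (fullshift R d) R,
    forall f, continuous f -> \int[nu]_x f x = I f.
Proof.
move=> pI; pose nu : probability _ R := riesz_measure pI; exists nu.
apply: positive_functional_ext => //; first exact: Rintegral_positive_functional.
move=> B cB; apply: EFin_inj; rewrite -probability_clopen//.
exact: riesz_measureE.
Qed.

(** Clopen sets form a generating family stable under intersection, and their indicators are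
    continuous; so [nu] and its image under the shift agree on this family, hence on all Borel
    sets. *)
Lemma integral_shift_invariant (R : realType) (d : nat)
    (nu : probability (fullshift R d) R) :
  (forall f, continuous f -> \int[nu]_x f (Defs.shift x) = \int[nu]_x f x) ->
  shift_invariant nu.
Proof.
move=> nuf B mB.
have mshift : measurable_fun setT (@Defs.shift R d).
  apply: (measurability _ (fullshift_borelE R d)).
  move=> _ [C cC <-]; rewrite setTI fullshift_borelE; apply: sub_sigma_algebra.
  apply: preimage_clopen => //; exact: shift_continuous.
pose m : {measure set (fullshift R d) -> \bar R} :=
  pushforward nu (@Defs.shift R d).
rewrite -[LHS]/(m mshift B).
apply: (@measure_unique _ R (fullshift R d) (@clopen (fullshift R d))
  (fun=> setT) (fullshift_borelE R d) (@clopenI _) _ _ (m mshift) nu) => //.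
- by move=> _; exact: clopenT.
- by apply/seteqP; split=> // x _; exists 0%N.
- move=> C cC; rewrite /m /= /pushforward.
  have cC' : clopen (@Defs.shift R d @^-1` C).
    apply: preimage_clopen => //; exact: shift_continuous.
  rewrite !probability_clopen//; congr EFin.
  rewrite -[RHS]nuf//; exact: clopen_indic_continuous.
- by move=> _; rewrite /m /= /pushforward preimage_setT probability_setT ltry.
Qed.

(** * Empirical measures of backward orbits *)

(** The image ultrafilter has a cluster point in the compact segment [[- M, M]], and an ultrafilter
    converges to each of its cluster points. *)
Lemma bounded_ultra_cvg (R : realType) (T : Type) (U : set_system T)
    (a : T -> R) (M : R) :
  UltraFilter U -> (forall n, `|a n| <= M) -> cvg (a @ U).
Proof.
move=> UU aM; have aU : (a @ U) [set` `[- M, M]].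
  by apply: (@filterE _ U) => n /=; rewrite in_itv/= -ler_norml.
have [p [_ pa]] := @segment_compact R (- M) M _ (fmap_proper_filter a _) aU.
apply/cvg_ex; exists p => B pB.
have [//|UB] := in_ultra_setVsetC (a @^-1` B) UU.
by have [r []] := pa (~` B) B UB pB.
Qed.

Lemma cvg_bounded_div_nat (R : realType) (b : nat -> R) (M : R) :
  (forall n, `|b n| <= M) -> (fun n => b n / n%:R) @ \oo --> (0 : R).
Proof.
move=> bM; apply/cvgrPdist_le => e e0.
near=> n.
have n0 : 0 < n%:R :> R by rewrite ltr0n; near: n; exact: nbhs_infty_gt.
rewrite sub0r normrN normrM normfV (gtr0_norm n0) ler_pdivrMr// (le_trans (bM n))//.
rewrite -ler_pdivrMl// mulrC; near: n; exact: nbhs_infty_ger.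
Unshelve. all: by end_near. Qed.

Section orbit_average.
Context (R : realType) (d : nat).
Local Notation X := (fullshift R d).
Implicit Types (f g : X -> R) (y : nat -> X).

(** At [n = 0] the value is [0]: bounds on the absolute value hold for all [n], but lower bounds
    only for [n > 0]. *)
Definition orbit_average y f (n : nat) : R := (\sum_(k < n) f (y k)) / n%:R.

Lemma orbit_average_le y f n M : (forall x, `|f x| <= M) ->
  `|orbit_average y f n| <= M.
Proof.
move=> fM; have M0 := le_trans (normr_ge0 _) (fM (y 0%N)).
rewrite /orbit_average; case: n => [|n]; first by rewrite invr0 mulr0 normr0.
rewrite normrM normfV normr_nat ler_pdivrMr ?ltr0n// (le_trans (ler_norm_sum _ _ _))//.
rewrite (le_trans (ler_sum _ (fun (k : 'I_n.+1) _ => fM (y k))))//.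
by rewrite sumr_const card_ord mulr_natr.
Qed.

Lemma orbit_average_ge y f n a : (forall k, a <= f (y k)) ->
  (0 < n)%N -> a <= orbit_average y f n.
Proof.
move=> af n0; rewrite /orbit_average ler_pdivlMr ?ltr0n// mulr_natr.
by rewrite (le_trans _ (ler_sum _ (fun (k : 'I_n) _ => af k)))// sumr_const card_ord.
Qed.

Section ultralimit.
Variables (y : nat -> X) (U : set_system nat).
Hypotheses (UU : UltraFilter U) (Uoo : \oo `<=` U).

(** With an ultrafilter, one and the same [U] gives a limit for all continuous [f] at once, without
    extracting subsequences. *)
Definition ultralimit f : R := lim (orbit_average y f @ U).

Lemma ultralimit_cvg f : continuous f -> orbit_average y f @ U --> ultralimit f.
Proof.
move=> cf; have [M fM] := continuous_bounded cf.
by apply: (@bounded_ultra_cvg _ _ _ _ M) => n; exact: orbit_average_le.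
Qed.

Lemma ultralimitE f (a : R) : orbit_average y f @ U --> a -> ultralimit f = a.
Proof. by move=> fa; exact: cvg_lim. Qed.

Lemma ultralimit_ge f (a : R) : continuous f -> (forall k, a <= f (y k)) ->
  a <= ultralimit f.
Proof.
move=> cf af; apply: limr_ge; first exact: (ultralimit_cvg cf).
by apply: Uoo; exists 1%N => // n /= n0; exact: orbit_average_ge.
Qed.

Lemma ultralimit_positive_functional : positive_functional ultralimit.
Proof.
split=> [f g cf cg|a f cf|f cf f0|].
- apply: ultralimitE.
  rewrite (_ : orbit_average _ _ = orbit_average y f \+ orbit_average y g).
    by apply: cvgD; exact: ultralimit_cvg.
  by apply/funext => n; rewrite /orbit_average/= -mulrDl big_split.
- apply: ultralimitE.
  rewrite (_ : orbit_average _ _ = (fun n => a * orbit_average y f n)).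
    by apply: cvgMr; exact: ultralimit_cvg.
  by apply/funext => n; rewrite /orbit_average mulrA mulr_sumr.
- exact: ultralimit_ge.
- apply: ultralimitE; apply: cvg_near_cst; apply: Uoo; exists 1%N => // n /= n0.
  by rewrite /orbit_average sumr_const card_ord divff// pnatr_eq0 -lt0n.
Qed.

(** The two averages differ by a telescoping sum divided by [n]; its boundary terms are bounded, so
    the difference tends to [0]. *)
Lemma ultralimit_shift f : continuous f ->
  (forall k, Defs.shift (y k.+1) = y k) ->
  ultralimit (f \o @Defs.shift R d) = ultralimit f.
Proof.
move=> cf yS; have [M fM] := continuous_bounded cf.
apply: ultralimitE.
(* For [n > 0] the second term is [f (y n.-1)]; written with the shift, the formula also covers
   [n = 0]. *)
pose b n := f (Defs.shift (y 0%N)) - f (Defs.shift (y n)).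
have b0 : (fun n => b n / n%:R) @ U --> (0 : R).
  apply: cvg_trans (@cvg_bounded_div_nat _ b (M + M) _).
    by move=> B ; apply: Uoo.
  by move=> n; rewrite (le_trans (ler_normB _ _))// lerD.
rewrite (_ : orbit_average _ _ = (fun n => orbit_average y f n + b n / n%:R)).
  by rewrite -[X in _ --> X]addr0; apply: cvgD => //; exact: ultralimit_cvg.
apply/funext => n; rewrite /orbit_average -mulrDl; congr (_ / _).
apply/eqP; rewrite addrC -subr_eq -sumrB /b; apply/eqP.
pose g k := - f (Defs.shift (y k)).
rewrite (eq_bigr (fun k : 'I_n => g k.+1 - g k)); last first.
  by move=> k _; rewrite /g yS opprK addrC.
rewrite -(big_mkord xpredT (fun k => g k.+1 - g k)) telescope_sumr//.
by rewrite /g opprK addrC.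
Qed.

End ultralimit.

(** Bounds are required along the orbit only, which is how relations valid just on [y] pass to
    integrals. *)
Lemma backward_orbit_measure y : (forall k, Defs.shift (y k.+1) = y k) ->
  exists nu : probability X R,
    (forall f, continuous f -> \int[nu]_x f (Defs.shift x) = \int[nu]_x f x) /\
    (forall f a, continuous f -> (forall k, a <= f (y k)) ->
      a <= \int[nu]_x f x).
Proof.
move=> yS; have [U [UU Uoo]] := ultraFilterLemma eventually_filter.
have [nu nuE] := riesz_representation (ultralimit_positive_functional y UU Uoo).
exists nu; split=> [f cf|f a cf af]; last first.
  by rewrite nuE//; exact: ultralimit_ge.
rewrite [RHS]nuE// -ultralimit_shift//; apply: (nuE (f \o @Defs.shift R d)).
by move=> x; apply: continuous_comp; [exact: shift_continuous|exact: cf].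
Qed.

End orbit_average.

(** * Calibrated subactions *)

Section calibrated.
Context (R : realType) (d : nat).
Local Notation X := (fullshift R d).
Implicit Types (A u v : X -> R).

(** Iterate the choice of a preimage attaining the maximum in the calibration equation. *)
Lemma calibrated_backward_orbit A u x : calibrated_subaction A u ->
  exists y : nat -> X, y 0%N = x /\ forall k, Defs.shift (y k.+1) = y k /\
    u (y k) = A (y k.+1) + u (y k.+1) - ergodic_max A.
Proof.
move=> [_ cu].
have pre z : {t | Defs.shift t = z /\ u z = A t + u t - ergodic_max A}.
  by apply: cid; have [[t /= tz <-] _] := cu z; exists t.
exists (fun k => iter k (fun z => sval (pre z)) x); split=> // k.
exact: svalP (pre _).
Qed.

Lemma calibrated_le_integral A u v (mu : probability X R) x :
  lipschitz_continuous A ->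
  calibrated_subaction A u -> calibrated_subaction A v ->
  (forall nu, maximizing A nu -> forall B, measurable B -> nu B = mu B) ->
  u x - v x <= \int[mu]_t (u t - v t).
Proof.
move=> /lipschitz_continuous_continuous cA calu calv mu_uniq.
have [y [y0 yS]] := calibrated_backward_orbit x calu.
have cu := calu.1; have cv := calv.1.
have cN f : continuous f -> continuous (fun t : X => - f t : R).
  by move=> cf t; exact: (@cvgN _ _ _ (nbhs t) _ _ _ (cf t)).
have cB f g : continuous f -> continuous g ->
    continuous (fun t : X => f t - g t : R).
  by move=> cf cg; apply: fullshift_continuousD => //; exact: cN.
have w_incr k : u (y k) - v (y k) <= u (y k.+1) - v (y k.+1).
  have [yk ->] := yS k; have [_ v_ge] := calv.2 (y k).
  have {}v_ge : A (y k.+1) + v (y k.+1) - ergodic_max A <= v (y k).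
    by apply: v_ge; exists (y k.+1).
  rewrite lerBlDr (le_trans _ (lerD (lexx _) v_ge))//.
  by rewrite le_eqVlt; apply/orP; left; apply/eqP; ring.
have w_ge k : u x - v x <= u (y k) - v (y k).
  by elim: k => [|k /le_trans]; [rewrite y0|apply; exact: w_incr].
(* The orbit is started at [y 1], because calibration determines the function [h] below only at the
   points [y k.+1]. *)
have [nu [nu_shift nu_ge]] := backward_orbit_measure (fun k => (yS k.+1).1).
have cus : continuous (u \o @Defs.shift R d).
  by move=> t; apply: continuous_comp; [exact: shift_continuous|exact: cu].
(* [h] differs from [A] by a coboundary, so it has the same [nu]-integral, and it is constant along
   the orbit. *)
pose h t := A t - (u (Defs.shift t) - u t).
have ch : continuous h by apply: (cB) => //; exact: (cB (u \o @Defs.shift R d)).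
have hE k : h (y k.+1) = ergodic_max A.
  by rewrite /h (yS k).1 (yS k).2; ring.
have intA : \int[nu]_t A t = ergodic_max A.
  have -> : \int[nu]_t A t = \int[nu]_t h t.
    rewrite RintegralB//; last 2 first.
    - exact: continuous_integrable.
    - by apply: continuous_integrable; exact: (cB (u \o @Defs.shift R d)).
    rewrite RintegralB ?nu_shift ?subrr ?subr0//; last exact: continuous_integrable.
    exact: (continuous_integrable _ cus).
  apply/eqP; rewrite eq_le; apply/andP; split; last first.
    by apply: nu_ge => // k; rewrite hE.
  (* The upper bound on the integral is the lower bound for [-1 * h], as [h] is constant on the
     orbit. *)
  rewrite -lerN2 -[leRHS]mulN1r -RintegralZl//; last exact: continuous_integrable.
  by apply: nu_ge => [|k]; [exact: fullshift_continuousZ|rewrite hE mulN1r].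
have nu_mu : maximizing A nu.
  by split=> //; exact: integral_shift_invariant.
have -> : \int[mu]_t (u t - v t) = \int[nu]_t (u t - v t).
  congr fine; apply: eq_measure_integral => B mB _.
  exact: esym (mu_uniq _ nu_mu _ mB).
by apply: nu_ge => [|k]; [exact: cB|exact: w_ge].
Qed.

End calibrated.

Theorem theorem4p9 (R : realType) (d : nat) (A : fullshift R d -> R)
    (lipA : lipschitz_continuous A) (uniqA : unique_maximizing A)
    (u v : fullshift R d -> R)
    (calu : calibrated_subaction A u) (calv : calibrated_subaction A v) :
  exists c : R, forall x : fullshift R d, u x = v x + c.
Proof.
have [mu [_ mu_uniq]] := uniqA; exists (\int[mu]_t (u t - v t)) => x.
apply/eqP; rewrite addrC -subr_eq eq_le; apply/andP; split.
  exact: calibrated_le_integral lipA calu calv mu_uniq.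
have := calibrated_le_integral x lipA calv calu mu_uniq.
have intu := continuous_integrable mu calu.1.
have intv := continuous_integrable mu calv.1.
by rewrite !RintegralB// -[v x - u x]opprB -[leRHS]opprB lerN2.
Qed.
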